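(* In the setting described in the context (discrete or continuous case, with $\Pi_r^Xx\to x$ for all $x\in X$ as $r$ increases), assume $L$ is bounded and $\{\Pi_r^Y\}$ is uniformly bounded in operator norm. If $y\in\mathcal{R}(L)$, then $\Pi_r^Yy\to y$ in $Y$ as $r$ increases. In addition, if $\mathcal{R}(L)$ is dense in $Y$, then $\Pi_r^Yy\to y$ for all $y\in Y$.
   Context: Scalars are $\mathbb{K}=\mathbb{R}$ or $\mathbb{C}$; inner products are linear in the first argument. $X,Y$ are separable Hilbert spaces and $L:\mathcal{D}(L)\subset X\to Y$ is a linear operator. A ''bounded'' operator is by convention defined on the whole space. Discrete case: $s\ge1$, weights $\gamma_1,\dots,\gamma_s>0$, $S=\mathbb{K}^s$ with $(u,v)_S=\sum_{j=1}^s\gamma_ju_j\overline{v_j}$, data $\{w_j\}_{j=1}^s\subset\mathcal{D}(L)$, and POD operator $K:S\to X$, $Kf=\sum_{j=1}^s\gamma_jf_jw_j$. Continuous case: $\mathcal{O}\subset\mathbb{R}^d$ open, $m\ge1$, $S=L^2(\mathcal{O};\mathbb{K}^m)$, data $\{w_j\}_{j=1}^m\subset L^2(\mathcal{O};X)$, POD operator $K:S\to X$, $Kf=\sum_{j=1}^m\int_{\mathcal{O}}f_j(t)w_j(t)\,dt$; it is assumed that $w_j(t)\in\mathcal{D}(L)$ a.e., $Lw_j\in L^2(\mathcal{O};Y)$, and for all $f\in S$, $Kf\in\mathcal{D}(L)$ and $LKf=\sum_{j=1}^m\int_{\mathcal{O}}f_j(t)Lw_j(t)\,dt$ (automatic if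 $L$ is bounded). In both cases $K$ is compact with singular value decomposition $Kf=\sum_{k\ge1}\sigma_k(f,f_k)_S\varphi_k$, $\sigma_1\ge\sigma_2\ge\dots\ge0$, with orthonormal singular vectors $\{f_k\}\subset S$, $\{\varphi_k\}\subset X$. $s_X=\mathrm{rank}(K)\in\mathbb{N}\cup\{\infty\}$, so $\sigma_k>0$ exactly for $k\le s_X$, and then $\varphi_k=\sigma_k^{-1}Kf_k\in\mathcal{D}(L)$. For each positive integer $r$ with $\sigma_r>0$: $X_r=\mathrm{span}\{\varphi_k\}_{k=1}^r$; $\Pi_r^X:X\to X$ is the orthogonal projection onto $X_r$; $Y_r=LX_r=\mathrm{span}\{L\varphi_k\}_{k=1}^r$; $\Pi_r^Y:Y\to Y$ is a bounded linear projection onto $Y_r$, not necessarily orthogonal. Uniformly bounded means $\|\Pi_r^Y\|\le C$ for all such $r$, with $C$ independent of $r$. Standing assumption for pointwise convergence: $\{\varphi_k\}$ is an orthonormal basis of $X$ in the sense that $\Pi_r^Xx\to x$ for all $x\in X$ as $r$ increases. ''As $r$ increases'' means $r=1,2,\dots$ with $r\le s_X$: if $s_X=\infty$ it is the limit $r\to\infty$; if $s_X<\infty$, convergence to a limit means that the limit is attained at $r=s_X$. *)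

(* Defs.v *)
From HB Require Import structures.
From mathcomp Require Import all_boot all_order all_algebra.
From mathcomp Require Import complex.
From mathcomp Require Import all_classical all_reals all_analysis.

Set Implicit Arguments.
Unset Strict Implicit.
Unset Printing Implicit Defensive.

Import Order.TTheory GRing.Theory Num.Theory.
Import numFieldNormedType.Exports.

Local Open Scope classical_set_scope.
Local Open Scope ring_scope.

(** * Scalars: the field of real or of complex numbers *)

Inductive scalar_kind := RealScalars | ComplexScalars.

Definition scalar_field (R : realType) (F : scalar_kind) : numFieldType :=
  match F with
  | RealScalars => R
  | ComplexScalars => R[i]
  end.

Definition of_real (R : realType) (F : scalar_kind) : R -> scalar_field R F :=
  match F with
  | RealScalars => fun x : R => x
  | ComplexScalars => fun x : R => (x%:C)%C
  end.

Definition re_part (R : realType) (F : scalar_kind) : scalar_field R F -> R :=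
  match F with
  | RealScalars => fun z : R => z
  | ComplexScalars => fun z : R[i] => complex.Re z
  end.

Definition conj_scalar (R : realType) (F : scalar_kind) :
    scalar_field R F -> scalar_field R F :=
  match F with
  | RealScalars => fun z : R => z
  | ComplexScalars => fun z : R[i] => (z^*)%C
  end.

(* The norm of a normedModType over K takes its values in K itself, where it
   is a nonnegative real element: rnorm is the same norm with values in R. *)
Definition rnorm (R : realType) (F : scalar_kind)
    (V : normedModType (scalar_field R F)) (x : V) : R := re_part `|x|.

(** * Hilbert spaces *)

(* The inner product is linear in the first argument and induces the norm. *)
HB.mixin Record isHilbert (R : realType) (F : scalar_kind) V
    of CompleteNormedModule (scalar_field R F) V := {
  inner : V -> V -> scalar_field R F ;
  innerDl : forall x y z, inner (x + y) z = inner x z + inner y z ;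
  innerZl : forall (a : scalar_field R F) x z, inner (a *: x) z = a * inner x z ;
  inner_conj : forall x y, inner y x = conj_scalar (inner x y) ;
  inner_norm : forall x, inner x x = `|x| ^+ 2
}.

#[short(type="hilbertType")]
HB.structure Definition Hilbert (R : realType) (F : scalar_kind) :=
  { V of CompleteNormedModule (scalar_field R F) V & isHilbert R F V }.

Definition separable_space (T : topologicalType) :=
  exists2 D : set T, countable D & dense D.

(** * Lebesgue measure on R^d *)

Notation Rn R d := (d.-tuple (measurableTypeR R)).

Definition Rn_cons (R : realType) (d : nat) (p : measurableTypeR R * Rn R d) :
  Rn R d.+1 := [tuple of p.1 :: p.2].

Section lebesgue_measureS.
Variables (R : realType) (d : nat).
Variable mu : {sigma_finite_measure set (Rn R d) -> \bar R}.

Definition lebesgueS : set (Rn R d.+1) -> \bar R :=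
  pushforward (lebesgue_measure \x mu)%E (@Rn_cons R d).

Let mcons : measurable_fun setT (@Rn_cons R d).
Proof. exact: measurable_cons. Qed.

Let lebesgueS0 : lebesgueS set0 = 0%E.
Proof. by rewrite /lebesgueS /pushforward preimage_set0 measure0. Qed.

Let lebesgueS_ge0 A : (0 <= lebesgueS A)%E.
Proof. exact: measure_ge0. Qed.

Let lebesgueS_sigma_additive : semi_sigma_additive lebesgueS.
Proof.
move=> F mF tF mUF; rewrite /lebesgueS /pushforward preimage_bigcup.
apply: measure_semi_sigma_additive.
- by move=> n; rewrite -[X in measurable X]setTI; exact: mcons.
- apply/trivIsetP => i j _ _ ij; rewrite -preimage_setI.
  by move/trivIsetP : tF => /(_ _ _ _ _ ij) ->//; rewrite preimage_set0.
- by rewrite -preimage_bigcup -[X in measurable X]setTI; exact: mcons.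
Qed.

HB.instance Definition _ := isMeasure.Build _ _ _ lebesgueS
  lebesgueS0 lebesgueS_ge0 lebesgueS_sigma_additive.

Let lebesgueS_sigma_finite : sigma_finite setT lebesgueS.
Proof.
have /sigma_finiteP[F [FT ndF Foo]] := sigma_finiteT (@lebesgue_measure R).
have /sigma_finiteP[G [GT ndG Goo]] := sigma_finiteT mu.
pose hd (t : Rn R d.+1) : measurableTypeR R := tnth t ord0.
pose tl (t : Rn R d.+1) : Rn R d := [tuple of behead t].
exists (fun n => (hd @^-1` F n) `&` (tl @^-1` G n)).
  rewrite predeqE => t; split => // _.
  have [i _ Fi] : (\bigcup_i F i) (hd t) by rewrite -FT.
  have [j _ Gj] : (\bigcup_i G i) (tl t) by rewrite -GT.
  exists (maxn i j) => //; split => /=.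
    by move: (hd t) Fi; exact/subsetPset/ndF/leq_maxl.
  by move: (tl t) Gj; exact/subsetPset/ndG/leq_maxr.
move=> n; have [mFn Fnoo] := Foo n; have [mGn Gnoo] := Goo n; split.
  apply: measurableI.
    by rewrite -[X in measurable X]setTI; exact: measurable_tnth.
  by rewrite -[X in measurable X]setTI; exact: measurable_behead.
rewrite /lebesgueS /pushforward.
rewrite (_ : _ @^-1` _ = F n `*` G n).
  by rewrite product_measure1E// lte_mul_pinfty// ge0_fin_numE.
have tlK x t : tl (Rn_cons (x, t)) = t by exact: val_inj.
by apply/seteqP; split => -[x t] /=; rewrite tlK.
Qed.

HB.instance Definition _ := Measure_isSigmaFinite.Build _ _ _ lebesgueS
  lebesgueS_sigma_finite.

End lebesgue_measureS.

(* The d-fold product of the Lebesgue measure on R, built by pushing forward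
   lebesgue_measure \x lebesgue_Rn d along (x, t) |-> x :: t. *)
Fixpoint lebesgue_Rn (R : realType) (d : nat) :
    {sigma_finite_measure set (Rn R d) -> \bar R} :=
  match d with
  | 0 => dirac [tuple]
  | d'.+1 => lebesgueS (lebesgue_Rn R d')
  end.

Definition Rn_open (R : realType) (d : nat) (U : set (Rn R d)) :=
  open [set x : 'rV[R]_d | U [tuple x ord0 i | i < d]].

(** * L^2 spaces of vector-valued functions and the Bochner integral *)

Section bochner.
Context (d : measure_display) (T : measurableType d) (R : realType).
Context (F : scalar_kind) (V : normedModType (scalar_field R F)).
Variables (mu : {measure set T -> \bar R}) (D : set T).
Implicit Types (s g : T -> V) (v : V).

Definition simple_integrable s :=
  [/\ finite_set (range s),
      (forall v, measurable (D `&` s @^-1` [set v])) &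
      (forall v, v != 0 -> (mu (D `&` s @^-1` [set v]) < +oo)%E)].

Definition simple_integral s : V :=
  \sum_(v \in range s) of_real F (fine (mu (D `&` s @^-1` [set v]))) *: v.

Definition ae_limit_on (s_ : (T -> V)^nat) g :=
  {ae mu, forall t, D t -> s_ n t @[n --> \oo] --> g t}.

(* The measures used below are sigma-finite, so that requiring the simple
   functions to be integrable does not restrict strong measurability. *)
Definition strongly_measurable g :=
  exists2 s_ : (T -> V)^nat, (forall n, simple_integrable (s_ n)) &
    ae_limit_on s_ g.

Definition is_bochner_integral g v :=
  exists s_ : (T -> V)^nat,
    [/\ (forall n, simple_integrable (s_ n)),
        ae_limit_on s_ g,
        (\int[mu]_(t in D) (rnorm (g t - s_ n t))%:E)%E @[n --> \oo] --> 0%E &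
        simple_integral (s_ n) @[n --> \oo] --> v].

(* 0 when g is not Bochner integrable on D *)
Definition bochner_integral g : V := xget 0 (is_bochner_integral g).

Definition L2 : set (T -> V) := [set g | strongly_measurable g /\
  (\int[mu]_(t in D) ((rnorm (g t)) ^+ 2)%:E < +oo)%E].

End bochner.

(** * POD data and POD operator *)

(* In the continuous case the elements of S are represented by functions, with
   no quotient by almost everywhere equality. 'rV_m carries the maximum norm,
   which is equivalent to the Euclidean norm of K^m: both give the same L^2. *)
Inductive pod_data (R : realType) (F : scalar_kind) (X : hilbertType R F) :=
| Discrete (s : nat) (s_ge1 : (1 <= s)%N)
    (gamma : 'I_s -> R) (gamma_gt0 : forall j, 0 < gamma j)
    (w : 'I_s -> X)
| Continuous (d m : nat) (m_ge1 : (1 <= m)%N)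
    (U : set (Rn R d)) (U_open : Rn_open U)
    (w : 'I_m -> Rn R d -> X) (w_L2 : forall j, L2 (lebesgue_Rn R d) U (w j)).

Section pod.
Context (R : realType) (F : scalar_kind) (X : hilbertType R F).
Implicit Type P : pod_data X.
Local Notation K := (scalar_field R F).

Definition pod_carrier P : Type :=
  match P with
  | Discrete s _ _ _ _ => 'rV[K]_s
  | Continuous d m _ _ _ _ _ => Rn R d -> 'rV[K]_m
  end.

Definition pod_space P : set (pod_carrier P) :=
  match P with
  | Discrete _ _ _ _ _ => setT
  | Continuous d m _ U _ _ _ => L2 (lebesgue_Rn R d) U
  end.

Definition pod_inner P : pod_carrier P -> pod_carrier P -> K :=
  match P with
  | Discrete s _ gamma _ _ => fun u v : 'rV[K]_s =>
      \sum_(j < s) of_real F (gamma j) * u ord0 j * conj_scalar (v ord0 j)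
  | Continuous d m _ U _ _ _ => fun f g : Rn R d -> 'rV[K]_m =>
      bochner_integral (lebesgue_Rn R d) U
        (fun t => \sum_(j < m) f t ord0 j * conj_scalar (g t ord0 j))
  end.

Definition pod_op P : pod_carrier P -> X :=
  match P with
  | Discrete s _ gamma _ w => fun f : 'rV[K]_s =>
      \sum_(j < s) (of_real F (gamma j) * f ord0 j) *: w j
  | Continuous d m _ U _ w _ => fun f : Rn R d -> 'rV[K]_m =>
      \sum_(j < m)
        bochner_integral (lebesgue_Rn R d) U (fun t => f t ord0 j *: w j t)
  end.

(* Singular value decomposition of the POD operator; the index k stands for
   the (k + 1)-th singular triple. Orthonormality is only required of the
   singular vectors with a nonzero singular value: the other ones play no role
   and there may be only finitely many of them. *)
Record is_svd P (sigma : nat -> R) (f : nat -> pod_carrier P)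
    (phi : nat -> X) : Prop := IsSVD {
  svd_ge0 : forall k, 0 <= sigma k ;
  svd_nonincreasing : forall k l, (k <= l)%N -> sigma l <= sigma k ;
  svd_right_mem : forall k, 0 < sigma k -> pod_space (f k) ;
  svd_right_orthonormal : forall k l, 0 < sigma k -> 0 < sigma l ->
    pod_inner (f k) (f l) = (k == l)%:R ;
  svd_left_orthonormal : forall k l, 0 < sigma k -> 0 < sigma l ->
    inner (phi k) (phi l) = (k == l)%:R ;
  svd_expansion : forall g, pod_space g ->
    \sum_(k < n) (of_real F (sigma k) * pod_inner g (f k)) *: phi k
      @[n --> \oo] --> pod_op g
}.

End pod.

(** * Ranks, projections, convergence as the order increases *)

Section linear_notions.
Context (R : realType) (F : scalar_kind).
Local Notation K := (scalar_field R F).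

Definition linspan (V : lmodType K) (r : nat) (v : nat -> V) : set V :=
  [set x | exists a : 'I_r -> K, x = \sum_(k < r) a k *: v k].

Definition lin_indep (V : lmodType K) (r : nat) (v : nat -> V) :=
  forall a : 'I_r -> K, \sum_(k < r) a k *: v k = 0 -> forall k, a k = 0.

Definition has_dim (V : lmodType K) (E : set V) (n : nat) :=
  exists2 v : nat -> V, lin_indep n v & E = linspan n v.

(* Ranks take their values in nat extended with None for infinity. *)
Definition is_rank (X : hilbertType R F) (P : pod_data X) (s : option nat) :=
  let range_op := pod_op (P := P) @` pod_space (P := P) in
  if s is Some n then has_dim range_op n else forall n, ~ has_dim range_op n.

(* r ranges over the positive integers at most s. *)
Definition is_order (r : nat) (s : option nat) : bool :=
  (0 < r)%N && (if s is Some n then (r <= n)%N else true).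

(* Convergence as r increases up to the rank s: for a finite s, the limit is
   attained at r = s. For s = 0 there is no order r, and the projection onto
   the span of the empty family is 0. *)
Definition cvg_rank (V : normedModType K) (s : option nat) (u : nat -> V)
    (l : V) :=
  match s with
  | Some 0 => 0 = l
  | Some n => u n = l
  | None => u r @[r --> \oo] --> l
  end.

Definition is_projection (V : lmodType K) (p : V -> V) (E : set V) :=
  p \o p = p /\ range p = E.

Definition is_orthogonal_projection (V : hilbertType R F) (p : V -> V)
    (E : set V) :=
  is_projection p E /\ forall x z, E z -> inner (x - p x) z = 0.

Definition opnorm (V W : normedModType K) (A : V -> W) : \bar R :=
  ereal_sup [set (rnorm (A x))%:E | x in [set x | rnorm x <= 1]].

Definition bounded_op (V W : normedModType K) (A : V -> W) :=
  (opnorm A < +oo)%E.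

End linear_notions.

(* Main.v *)
Require Import Defs.
From mathcomp Require Import all_boot all_order all_algebra.
From mathcomp Require Import complex.
From mathcomp Require Import all_classical all_reals all_analysis.

Set Implicit Arguments.
Unset Strict Implicit.
Unset Printing Implicit Defensive.

Import Order.TTheory GRing.Theory Num.Theory.
Import numFieldNormedType.Exports.

Local Open Scope classical_set_scope.
Local Open Scope ring_scope.

(** The operators [PiY r] fix every vector of [L X_r], so they fix
    [L (PiX r x)].  For [y = L x] this gives

      [L x - PiY r (L x) = L (x - PiX r x) - PiY r (L (x - PiX r x))],

    whose norm is at most [(1 + c) * b * `|x - PiX r x|] when [b] bounds [L]
    and [c] bounds all the [PiY r]; the right-hand side tends to 0 because
    [PiX r x] tends to [x] ([cvg_projection_range]).  If [range L] is dense,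
    the bound [c] extends the convergence to all of [Y] by the usual
    approximation argument ([cvg_dense_uniform]).

    Convergence up to a finite rank [n] means that the limit is attained at
    [r = n], which is convergence of the constant sequence of the [n]-th terms.
    [rank_family] replaces a family of operators by that constant one, so that
    a single argument on sequences covers finite and infinite ranks: for a
    positive finite rank, the passage from a dense range to [Y] is then the closedness
    of the set of fixed points of [PiY n]. *)

Section norm_bounds.
Context (R : realType) (F : scalar_kind).
Local Notation K := (scalar_field R F).

Lemma of_real_re_part (z : K) : 0 <= z -> of_real F (re_part z) = z.
Proof.
by case: F z => //= z z0; rewrite RRe_real// ger0_real.
Qed.

Lemma of_real_ge0 (a : R) : (0 <= of_real F a) = (0 <= a).
Proof. by case: F => //=; rewrite lecR. Qed.

Lemma rnorm_le (V : normedModType K) (x : V) (a : R) :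
  (rnorm x <= a) = (`|x| <= of_real F a).
Proof.
rewrite /rnorm -[in RHS](of_real_re_part (normr_ge0 x)).
by case: F V x => //= V x; rewrite lecR.
Qed.

(** The operator norm is a supremum over the unit ball; scaling [x] by the
    inverse of its norm turns it into a homogeneous bound. *)
Lemma opnorm_le_bound (V W : normedModType K) (A : {linear V -> W}) (c : R) :
  (opnorm A <= c%:E)%E -> forall x, `|A x| <= of_real F c * `|x|.
Proof.
move=> Ac x.
have unit_bound z : `|z| <= 1 -> `|A z| <= of_real F c.
  move=> z1; rewrite -rnorm_le -lee_fin; apply: le_trans Ac.
  apply: ereal_sup_ubound; exists z => //=.
  by rewrite rnorm_le; case: (F) (V) z z1.
have [->|x0] := eqVneq x 0; first by rewrite raddf0 !normr0 mulr0.
have nx0 : 0 < `|x| by rewrite normr_gt0.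
have := unit_bound (`|x|^-1 *: x).
rewrite linearZ !normrZ normfV normr_id mulVf ?gt_eqF// => /(_ (lexx _)).
by rewrite mulrC ler_pdivrMr.
Qed.

Lemma opnorm_ge0 (V W : normedModType K) (A : {linear V -> W}) :
  (0 <= opnorm A)%E.
Proof.
apply: ereal_sup_ubound; exists 0 => /=.
  by rewrite rnorm_le normr0 of_real_ge0.
by rewrite /rnorm raddf0 normr0; case: (F).
Qed.

Lemma bounded_op_bound (V W : normedModType K) (A : {linear V -> W}) :
  bounded_op A -> exists2 b : K, 0 <= b & forall x, `|A x| <= b * `|x|.
Proof.
move=> Aoo; have A0 := opnorm_ge0 A.
exists (of_real F (fine (opnorm A))); first by rewrite of_real_ge0 fine_ge0.
by apply: opnorm_le_bound; rewrite fineK// ge0_fin_numE.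
Qed.

End norm_bounds.

Section convergence.
Context (K : numFieldType).

Lemma cvg_dist_le (V W : normedModType K) (k : K) (u : nat -> V) (l : V)
    (v : nat -> W) (m : W) : 0 <= k ->
  (\forall r \near \oo, `|l - u r| <= k * `|m - v r|) ->
  v r @[r --> \oo] --> m -> u r @[r --> \oo] --> l.
Proof.
move=> k0 uv /cvgrPdist_lt vm; apply/cvgrPdist_lt => e e0.
have k1 : 0 < k + 1 by rewrite ltr_wpDl.
near=> r; apply: (@le_lt_trans _ _ (k * `|m - v r|)); first by near: r.
apply: (@le_lt_trans _ _ ((k + 1) * `|m - v r|)).
  by rewrite ler_wpM2r// lerDl.
rewrite mulrC -ltr_pdivlMr//; near: r; apply: vm.
by rewrite divr_gt0.
Unshelve. all: by end_near. Qed.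

(** The quasi-optimality argument: [T r] fixes [A (Q r x)], so the error of
    [T r] at [A x] is the image of the error [x - Q r x] under
    [(id - T r) \o A], which is bounded independently of [r]. *)
Lemma cvg_projection_range (V W : normedModType K) (A : {linear V -> W})
    (Q : nat -> {linear V -> V}) (T : nat -> {linear W -> W}) (b c : K) (x : V) :
  0 <= b -> (forall z, `|A z| <= b * `|z|) ->
  0 <= c -> (\forall r \near \oo, forall y, `|T r y| <= c * `|y|) ->
  (\forall r \near \oo, T r (A (Q r x)) = A (Q r x)) ->
  Q r x @[r --> \oo] --> x -> T r (A x) @[r --> \oo] --> A x.
Proof.
move=> b0 Ab c0 Tc TQ; apply: (@cvg_dist_le _ _ ((1 + c) * b)).
  by rewrite mulr_ge0// addr_ge0.
near=> r.
have -> : A x - T r (A x) = A (x - Q r x) - T r (A (x - Q r x)).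
  have TQr : T r (A (Q r x)) = A (Q r x) by near: r.
  by rewrite (raddfB A) (raddfB (T r)) /= TQr opprB addrA subrK.
apply: (le_trans (ler_normB _ _)).
have Tr : forall y, `|T r y| <= c * `|y| by near: r.
apply: (le_trans (lerD (lexx _) (Tr _))).
by rewrite -[X in X + _]mul1r -mulrDl -mulrA ler_wpM2l// addr_ge0.
Unshelve. all: by end_near. Qed.

(** The easy half of the Banach-Steinhaus theorem. *)
Lemma cvg_dense_uniform (W : normedModType K) (T : nat -> {linear W -> W})
    (D : set W) (c : K) :
  0 <= c -> (\forall r \near \oo, forall y, `|T r y| <= c * `|y|) ->
  dense D -> (forall z, D z -> T r z @[r --> \oo] --> z) ->
  forall y, T r y @[r --> \oo] --> y.
Proof.
move=> c0 Tc dD TD y; apply/cvgrPdist_lt => e e0.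
have c1 : 0 < 1 + c by rewrite ltr_wpDr.
(* [id - T r] has norm at most [1 + c], so it moves [y - z] by less than
   [e / 2] as soon as [y] and [z] are at distance less than [d]. *)
pose d := e / 2 / (1 + c).
have d0 : 0 < d by rewrite !divr_gt0.
have [z [/= yz Dz]] : ball y d `&` D !=set0.
  apply: dD; last exact: ball_open.
  by exists y; exact: ballxx.
rewrite -ball_normE /= in yz.
near=> r.
have -> : y - T r y = (y - z - T r (y - z)) + (z - T r z).
  rewrite (raddfB (T r)) /= opprD opprK (addrACA y) -[RHS]addrA (addrACA (- z)).
  by rewrite addNr subrr !addr0.
rewrite [e]splitr; apply: (le_lt_trans (ler_normD _ _)).
apply: ltrD; last first.
  by near: r; move/cvgrPdist_lt : (TD z Dz); apply; rewrite divr_gt0.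
have Tr : forall y, `|T r y| <= c * `|y| by near: r.
apply: (le_lt_trans (ler_normB _ _)).
apply: (le_lt_trans (lerD (lexx _) (Tr _))).
by rewrite -[X in X + _]mul1r -mulrDl mulrC -ltr_pdivlMr.
Unshelve. all: by end_near. Qed.

End convergence.

Section rank_family.
Context (R : realType) (F : scalar_kind).
Local Notation K := (scalar_field R F).

(** At rank 0 the projection onto the span of no vector is the zero map. *)
Definition rank_family (V W : normedModType K) (s : option nat)
    (A : nat -> {linear V -> W}) (r : nat) : {linear V -> W} :=
  match s with
  | Some 0 => \0
  | Some n => A n
  | None => A r
  end.

Lemma cvg_rankP (V W : normedModType K) (s : option nat)
    (A : nat -> {linear V -> W}) (x : V) (l : W) :
  cvg_rank s (fun r => A r x) l <->
  rank_family s A r x @[r --> \oo] --> l.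
Proof.
have cst (a : W) : a = l <-> a @[r --> \oo] --> l.
  split=> [->|al]; first exact: cvg_cst.
  exact: (cvg_unique _ (cvg_cst a) al).
by case: s => [[|n]|] /=.
Qed.

(** The bound is only eventual: for an infinite rank the family starts at the
    index 0, which is not an order.  The maximum with 0 makes the constant
    nonnegative even at rank 0, where there is no order at all. *)
Lemma rank_family_bound (V W : normedModType K) (s : option nat)
    (A : nat -> {linear V -> W}) (C : R) :
  (forall r, is_order r s -> (opnorm (A r) <= C%:E)%E) ->
  exists2 c : K, 0 <= c &
    \forall r \near \oo, forall x, `|rank_family s A r x| <= c * `|x|.
Proof.
move=> AC; pose c := of_real F (Num.max C 0).
have c0 : 0 <= c by rewrite of_real_ge0 le_max lexx orbT.
have Ac r : is_order r s -> forall x, `|A r x| <= c * `|x|.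
  move=> rs; apply: opnorm_le_bound; apply: (le_trans (AC r rs)).
  by rewrite lee_fin le_max lexx.
exists c => //; near=> r => x.
have r0 : (0 < r)%N by near: r; exact: nbhs_infty_gt.
case: s AC Ac => [[|n]|] AC Ac /=.
- by rewrite normr0 mulr_ge0.
- by apply: Ac; rewrite /is_order /=.
- by apply: Ac; rewrite /is_order r0.
Unshelve. all: by end_near. Qed.

(** A projection fixes its range, and [A (Q r x)] lies in [A @` E r], which is
    the range of [T r]. *)
Lemma rank_family_projection (V W : hilbertType R F) (s : option nat)
    (A : {linear V -> W}) (E : nat -> set V) (Q : nat -> {linear V -> V})
    (T : nat -> {linear W -> W}) :
  (forall r, is_order r s -> is_projection (Q r) (E r)) ->
  (forall r, is_order r s -> is_projection (T r) (A @` E r)) ->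
  \forall r \near \oo, forall x,
    rank_family s T r (A (rank_family s Q r x)) = A (rank_family s Q r x).
Proof.
move=> Qproj Tproj.
have fixed r x : is_order r s -> T r (A (Q r x)) = A (Q r x).
  move=> rs; have [_ QE] := Qproj r rs; have [TT TE] := Tproj r rs.
  have [y _ <-] : range (T r) (A (Q r x)).
    by rewrite TE; exists (Q r x) => //; rewrite -QE; exists x.
  by rewrite -[LHS]/((T r \o T r) y) TT.
near=> r => x.
have r0 : (0 < r)%N by near: r; exact: nbhs_infty_gt.
case: s Qproj Tproj fixed => [[|n]|] Qproj Tproj fixed /=.
- by rewrite raddf0.
- by apply: fixed; rewrite /is_order /=.
- by apply: fixed; rewrite /is_order r0.
Unshelve. all: by end_near. Qed.

End rank_family.

Unset Implicit Arguments.

Theorem theorem6p1 (R : realType) (F : scalar_kind) (X Y : hilbertType R F)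
    (sepX : separable_space X) (sepY : separable_space Y)
    (L : {linear X -> Y})
    (P : pod_data X)
    (sigma : nat -> R) (f : nat -> pod_carrier P) (phi : nat -> X)
    (svd : is_svd sigma f phi)
    (sX : option nat) (rank_sX : is_rank P sX)
    (PiX : nat -> {linear X -> X})
    (PiX_proj : forall r, is_order r sX ->
      is_orthogonal_projection (PiX r) (linspan r phi))
    (PiY : nat -> {linear Y -> Y})
    (PiY_bounded : forall r, is_order r sX -> bounded_op (PiY r))
    (PiY_proj : forall r, is_order r sX ->
      is_projection (PiY r) (L @` linspan r phi))
    (PiX_cvg : forall x, cvg_rank sX (fun r => PiX r x) x)
    (L_bounded : bounded_op L)
    (PiY_unif : exists C : R, forall r, is_order r sX ->
      (opnorm (PiY r) <= C%:E)%E) :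
  (forall y, range L y -> cvg_rank sX (fun r => PiY r y) y) /\
  (dense (range L) -> forall y, cvg_rank sX (fun r => PiY r y) y).
Proof.
have [C PiYC] := PiY_unif.
have [c c0 Tc] := rank_family_bound PiYC.
have [b b0 Lb] := bounded_op_bound L_bounded.
have TQ := rank_family_projection
  (fun r rs => proj1 (PiX_proj r rs)) PiY_proj.
have on_range y : range L y -> rank_family sX PiY r y @[r --> \oo] --> y.
  case=> x _ <-; apply: (cvg_projection_range b0 Lb c0 Tc).
    by apply: filterS TQ => r; exact.
  by apply/cvg_rankP; exact: PiX_cvg.
split=> [y Ly|denseL y]; apply/cvg_rankP; first exact: on_range.
exact: (cvg_dense_uniform c0 Tc denseL).
Qed.
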